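(* Let $L_0=x_0I+y_0E\in LC_2$, and let $C$ be a smooth closed curve in $LC_2$ (identified with the plane $\mathbb{R}^2$ via $xI+yE\leftrightarrow(x,y)$) such that $L-L_0\in LC_2^*$ for each point $L=xI+yE$ on $C$. Then $$\oint_C\frac{dL}{L-L_0}=\mathbf{0}.$$
   Context: $\mathbb{P}_2$ is the real vector space of all functions $g:\mathbb{R}\to\mathbb{R}$ with $g(t+2)=g(t)$ for all $t$. $I$ is the identity operator and $E$ the unit shift $(Eg)(t)=g(t+1)$ on $\mathbb{P}_2$, so $E^2=I$. $LC_2=\{xI+yE: x,y\in\mathbb{R}\}$, with multiplication $(x_1I+y_1E)(x_2I+y_2E)=(x_1x_2+y_1y_2)I+(x_1y_2+x_2y_1)E$ and zero element $\mathbf{0}=0I+0E$. $LC_2^*=\{xI+yE: x^2-y^2\neq0\}$ is the set of invertible elements, and $\frac{1}{xI+yE}=\frac{x}{x^2-y^2}I-\frac{y}{x^2-y^2}E$. For a smooth curve $C$ parametrized by $(x(t),y(t))$, $t_0\le t\le t_1$, and $f(xI+yE)=u(x,y)I+v(x,y)E$, the line integral is $\int_C f(L)\,dL=\int_{t_0}^{t_1}[u(x(t),y(t))I+v(x(t),y(t))E][x'(t)I+y'(t)E]\,dt=I\int_{t_0}^{t_1}(u\,x'+v\,y')\,dt+E\int_{t_0}^{t_1}(v\,x'+u\,y')\,dt$. *)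

(* Defs.v *)
From Stdlib Require Import Reals Lra.
From Coquelicot Require Import Coquelicot.
Open Scope R_scope.

Record P2 := mkP2 { P2_fun :> R -> R; P2_periodic : forall t, P2_fun (t + 2) = P2_fun t }.

(** An element [xI + yE] of [LC_2] is stored by its coefficients.  This loses nothing: [LC2_op]
    gives the operator on [P2] that it denotes, and [LC2_op_inj], [LC2_op_mul] below show that
    the coefficients are determined by the operator and that products are compositions. *)
Record LC2 := mkLC2 { coefI : R; coefE : R }.

Definition LC2_zero : LC2 := mkLC2 0 0.
Definition LC2_one : LC2 := mkLC2 1 0.

Definition LC2_sub (L M : LC2) : LC2 :=
  mkLC2 (coefI L - coefI M) (coefE L - coefE M).

Definition LC2_mul (L M : LC2) : LC2 :=
  mkLC2 (coefI L * coefI M + coefE L * coefE M)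
        (coefI L * coefE M + coefE L * coefI M).

Definition LC2_unit (L : LC2) : Prop := coefI L ^ 2 - coefE L ^ 2 <> 0.

(** Meaningful only under [LC2_unit L]. *)
Definition LC2_inv (L : LC2) : LC2 :=
  mkLC2 (coefI L / (coefI L ^ 2 - coefE L ^ 2))
        (- (coefE L / (coefI L ^ 2 - coefE L ^ 2))).

Lemma LC2_op_periodic (L : LC2) (g : P2) (t : R) :
  coefI L * g (t + 2) + coefE L * g (t + 2 + 1) = coefI L * g t + coefE L * g (t + 1).
Proof.
  replace (t + 2 + 1) with (t + 1 + 2) by ring.
  now rewrite !P2_periodic.
Qed.

Definition LC2_op (L : LC2) (g : P2) : P2 :=
  mkP2 (fun t => coefI L * g t + coefE L * g (t + 1)) (LC2_op_periodic L g).

Lemma LC2_op_mul (L M : LC2) (g : P2) (t : R) :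
  LC2_op (LC2_mul L M) g t = LC2_op L (LC2_op M g) t.
Proof.
  simpl. replace (t + 1 + 1) with (t + 2) by ring.
  rewrite P2_periodic. ring.
Qed.

Lemma LC2_op_inj (L M : LC2) :
  (forall (g : P2) (t : R), LC2_op L g t = LC2_op M g t) -> L = M.
Proof.
  intros H.
  assert (H1 := H (mkP2 (fun _ => 1) (fun _ => eq_refl)) 0).
  assert (Hc : forall t, cos (PI * (t + 2)) = cos (PI * t)).
  { intros t. replace (PI * (t + 2)) with (PI * t + 2 * PI) by ring.
    now rewrite cos_plus, cos_2PI, sin_2PI, Rmult_0_r, Rminus_0_r, Rmult_1_r. }
  assert (H2 := H (mkP2 _ Hc) 0).
  simpl in H1, H2.
  rewrite Rplus_0_l, Rmult_0_r, Rmult_1_r, cos_0, cos_PI in H2.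
  destruct L as [a b], M as [c d]; simpl in *.
  f_equal; lra.
Qed.

Lemma LC2_mul_inv (L : LC2) : LC2_unit L -> LC2_mul L (LC2_inv L) = LC2_one.
Proof.
  destruct L as [a b]; unfold LC2_unit, LC2_mul, LC2_inv, LC2_one; simpl; intros H.
  f_equal; field; lra.
Qed.

Lemma LC2_unit_iff (L : LC2) : LC2_unit L <-> exists M, LC2_mul L M = LC2_one.
Proof.
  split.
  - intros H. exists (LC2_inv L). now apply LC2_mul_inv.
  - destruct L as [a b]. intros [[c d] H] H0.
    unfold LC2_mul, LC2_one in H; simpl in *.
    injection H as H1 H2.
    assert (Hn : (a ^ 2 - b ^ 2) * (c ^ 2 - d ^ 2) = 1).
    { transitivity ((a * c + b * d) ^ 2 - (a * d + b * c) ^ 2); [ring|].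
      rewrite H1, H2. ring. }
    replace (a ^ 2 - b ^ 2) with 0 in Hn by (rewrite <- H0; ring).
    lra.
Qed.

(** Continuously differentiable on the closed interval, derivative and continuity being
    one-sided at the endpoints: nothing is required of [f] outside [[a, b]].  When
    [locally t] replaces [within _ (locally t)], the first clause is [is_derive f t (f' t)]. *)
Definition C1_on (f : R -> R) (a b : R) : Prop :=
  exists f' : R -> R,
    forall t, a <= t <= b ->
      filterdiff f (within (fun s => a <= s <= b) (locally t)) (fun h => scal h (f' t)) /\
      filterlim f' (within (fun s => a <= s <= b) (locally t)) (locally (f' t)).

Definition smooth_curve (gamma : R -> LC2) (t0 t1 : R) : Prop :=
  C1_on (fun t => coefI (gamma t)) t0 t1 /\ C1_on (fun t => coefE (gamma t)) t0 t1.

(** The two-sided [Derive] may be meaningless at the endpoints of the parameter interval,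
    which does not affect the integrals below. *)
Definition velocity (gamma : R -> LC2) (t : R) : LC2 :=
  mkLC2 (Derive (fun s => coefI (gamma s)) t) (Derive (fun s => coefE (gamma s)) t).

Definition line_integral (f : LC2 -> LC2) (gamma : R -> LC2) (t0 t1 : R) : LC2 :=
  mkLC2 (RInt (fun t => coefI (LC2_mul (f (gamma t)) (velocity gamma t))) t0 t1)
        (RInt (fun t => coefE (LC2_mul (f (gamma t)) (velocity gamma t))) t0 t1).

(* Main.v *)
Require Import Defs.
From Stdlib Require Import Reals Lra.
From Coquelicot Require Import Coquelicot.
Open Scope R_scope.

(** Put [L - L0 = aI + bE], [p = a + b] and [q = a - b].  Since [E^2 = I], the map
    [aI + bE |-> (p, q)] is a ring isomorphism from [LC_2] onto the product [R x R] ([p] and [q]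
    are the eigenvalues of the operator on the functions with [Eg = g] and [Eg = -g]).  It turns
    [dL / (L - L0)] into the pair [(dp / p, dq / q)], and the unit condition [p q <> 0] into:
    [p] and [q] have no zero on the curve.  Hence each component has the single-valued primitive
    [ln |p|], [ln |q|] along the whole curve, and there is no winding number: each of the two real
    integrals is a difference of values of that primitive at the two ends, which is [0] for a
    closed curve ([is_RInt_log_derivative]).

    The curve is differentiable only one-sidedly at the ends of its parameter interval, whereas
    the integration theorems ask for two-sided hypotheses there.  The functions are therefore
    precomposed with the retraction [clamp] of the line onto the interval, which makes them
    continuous everywhere and changes nothing inside ([is_RInt_derive_interior]). *)

Definition clamp (a b t : R) : R := Rmax a (Rmin t b).

Lemma clamp_in (a b t : R) : a <= b -> a <= clamp a b t <= b.
Proof.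
  intros H. unfold clamp, Rmax, Rmin.
  repeat destruct Rle_dec; lra.
Qed.

Lemma clamp_id (a b t : R) : a <= t <= b -> clamp a b t = t.
Proof.
  intros H. unfold clamp, Rmax, Rmin.
  repeat destruct Rle_dec; lra.
Qed.

Lemma clamp_contract (a b s t : R) :
  Rabs (clamp a b s - clamp a b t) <= Rabs (s - t).
Proof.
  unfold clamp, Rmax, Rmin.
  repeat destruct Rle_dec; split_Rabs; lra.
Qed.

(** Turns one-sided continuity at the ends of [[a, b]] into continuity on the line. *)
Lemma continuous_clamp (f : R -> R) (a b : R) :
  a <= b ->
  (forall t, a <= t <= b ->
     filterlim f (within (fun s => a <= s <= b) (locally t)) (locally (f t))) ->
  forall t, continuous (fun s => f (clamp a b s)) t.
Proof.
  intros Hab Hf t.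
  apply (filterlim_comp _ _ _ (clamp a b) f _
           (within (fun s => a <= s <= b) (locally (clamp a b t)))).
  2: { apply Hf. now apply clamp_in. }
  intros P [e He]. exists e. intros s Hs.
  apply He; [|now apply clamp_in].
  apply (Rle_lt_trans _ (Rabs (s - t))); [apply clamp_contract | exact Hs].
Qed.

(** The fundamental theorem of calculus without differentiability at the end points: the
    difference between [F] and the integral of [h] is continuous and has derivative [0] inside,
    so the mean value theorem makes it constant. *)
Lemma is_RInt_derive_interior (F h : R -> R) (a b : R) :
  a < b ->
  (forall t, continuous F t) ->
  (forall t, continuous h t) ->
  (forall t, a < t < b -> is_derive F t (h t)) ->
  is_RInt h a b (F b - F a).
Proof.
  intros Hab HF Hh Hd.
  assert (Hex : forall t, ex_RInt h a t).
  { intros t. apply (@ex_RInt_continuous R_CompleteNormedModule). auto. }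
  assert (Hprim : forall t, is_derive (fun s => RInt h a s) t (h t)).
  { intros t. apply (is_derive_RInt h (fun s => RInt h a s) a); [|apply Hh].
    apply filter_forall. intros s. now apply (@RInt_correct R_CompleteNormedModule). }
  destruct (MVT_gen (fun t => F t - RInt h a t) a b (fun _ => 0)) as [c [_ Hc]].
  - rewrite Rmin_left, Rmax_right by lra. intros t Ht.
    replace 0 with (minus (h t) (h t)) by apply (@minus_eq_zero R_AbelianGroup).
    apply (is_derive_minus F (fun s => RInt h a s)); auto.
  - intros t _. apply continuity_pt_filterlim.
    apply (continuous_minus F (fun s => RInt h a s)); [apply HF|].
    apply (@ex_derive_continuous R_AbsRing R_NormedModule).
    now exists (h t).
  - rewrite RInt_point in Hc. change (@zero R_CompleteNormedModule) with 0 in Hc.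
    replace (F b - F a) with (RInt h a b) by lra.
    now apply (@RInt_correct R_CompleteNormedModule).
Qed.

Lemma filterdiff_within_is_derive (f : R -> R) (D : R -> Prop) (t l : R) :
  locally t D ->
  filterdiff f (within D (locally t)) (fun h => scal h l) ->
  is_derive f t l.
Proof.
  intros HD [Hlin Hdom]. split; [exact Hlin|].
  intros x Hx.
  apply (is_filter_lim_locally_unique t x) in Hx. subst x.
  assert (Ht : is_filter_lim (within D (locally t)) t).
  { intros P HP. unfold within. apply filter_imp with (2 := HP). auto. }
  intros eps. specialize (Hdom t Ht eps). unfold within in Hdom.
  apply filter_imp with (2 := filter_and _ _ HD Hdom).
  now intros s [H1 H2]; apply H2.
Qed.

Lemma locally_interval (a b t : R) :
  a < t < b -> locally t (fun s => a <= s <= b).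
Proof.
  intros Ht.
  apply (locally_interval _ t a b); simpl; try lra.
  intros s; simpl; lra.
Qed.

Lemma C1_on_ex_derive (f : R -> R) (a b t : R) :
  C1_on f a b -> a < t < b -> ex_derive f t.
Proof.
  intros [f' Hf] Ht. exists (f' t).
  apply (filterdiff_within_is_derive _ (fun s => a <= s <= b)).
  - now apply locally_interval.
  - apply Hf. lra.
Qed.

Lemma C1_on_const (c a b : R) : C1_on (fun _ => c) a b.
Proof.
  exists (fun _ => 0). intros t _. split.
  - apply (filterdiff_ext_lin _ (fun _ => zero)).
    + apply filterdiff_const.
    + intros h. symmetry. apply (@scal_zero_r R_Ring R_ModuleSpace).
  - apply filterlim_const.
Qed.

Lemma C1_on_plus (f g : R -> R) (a b : R) :
  C1_on f a b -> C1_on g a b -> C1_on (fun t => f t + g t) a b.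
Proof.
  intros [f' Hf] [g' Hg]. exists (fun t => f' t + g' t). intros t Ht.
  destruct (Hf t Ht) as [Hf1 Hf2], (Hg t Ht) as [Hg1 Hg2]. split.
  - apply (filterdiff_ext_lin _ (fun h : R_NormedModule => plus (scal h (f' t)) (scal h (g' t)))).
    + exact (filterdiff_plus_fct (V := R_NormedModule) f g _ _ Hf1 Hg1).
    + intros h. symmetry. apply (@scal_distr_l R_Ring R_ModuleSpace).
  - apply (filterlim_comp_2 (G := locally (f' t)) (H := locally (g' t))); auto.
    apply (filterlim_plus (f' t) (g' t)).
Qed.

Lemma C1_on_opp (f : R -> R) (a b : R) :
  C1_on f a b -> C1_on (fun t => - f t) a b.
Proof.
  intros [f' Hf]. exists (fun t => - f' t). intros t Ht.
  destruct (Hf t Ht) as [Hf1 Hf2]. split.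
  - apply (filterdiff_ext_lin _ (fun h : R_NormedModule => opp (scal h (f' t)))).
    + exact (filterdiff_opp_fct (V := R_NormedModule) f _ Hf1).
    + intros h. symmetry. apply (@scal_opp_r R_Ring R_ModuleSpace).
  - apply (filterlim_comp _ _ _ f' Ropp _ (locally (f' t))); auto.
    apply (filterlim_opp (f' t)).
Qed.

(** The primitive is [ln |f|], written [ln (f ^ 2) / 2] so that it is differentiable by the chain
    rule without discussing the sign of [f]. *)
Lemma is_RInt_log_derivative (f : R -> R) (a b : R) :
  a < b ->
  C1_on f a b ->
  (forall t, a <= t <= b -> f t <> 0) ->
  f a = f b ->
  is_RInt (fun t => Derive f t / f t) a b 0.
Proof.
  intros Hab [f' Hf] Hnz Hcl.
  set (F := fun t => ln (f (clamp a b t) ^ 2) / 2).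
  set (h := fun t => f' (clamp a b t) * / f (clamp a b t)).
  assert (Hd : forall t, a < t < b -> is_derive f t (f' t)).
  { intros t Ht.
    apply (filterdiff_within_is_derive _ (fun s => a <= s <= b)).
    - now apply locally_interval.
    - apply Hf. lra. }
  assert (Hln : forall x, x <> 0 -> is_derive (fun y => ln (y ^ 2) / 2) x (/ x)).
  { intros x Hx. auto_derive.
    - rewrite Rmult_1_r. now apply Rsqr_pos_lt.
    - now field. }
  assert (Hcf : forall t, continuous (fun s => f (clamp a b s)) t).
  { apply continuous_clamp; [lra|]. intros t Ht.
    apply (filterdiff_continuous_aux f (ex_intro _ _ (proj1 (Hf t Ht)))).
    intros P HP. unfold within. apply filter_imp with (2 := HP). auto. }
  assert (Hcf' : forall t, continuous (fun s => f' (clamp a b s)) t).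
  { apply continuous_clamp; [lra|]. intros t Ht. now apply Hf. }
  assert (Hnz' : forall t, f (clamp a b t) <> 0).
  { intros t. apply Hnz, clamp_in. lra. }
  replace 0 with (F b - F a).
  2: { unfold F. rewrite !clamp_id by lra. rewrite Hcl. ring. }
  apply (is_RInt_ext h).
  { rewrite Rmin_left, Rmax_right by lra. intros t Ht. unfold h.
    rewrite clamp_id by lra.
    now rewrite (is_derive_unique _ _ _ (Hd t Ht)). }
  apply is_RInt_derive_interior; [exact Hab| | |].
  - intros t.
    apply (continuous_comp (fun s => f (clamp a b s)) (fun y => ln (y ^ 2) / 2));
      [apply Hcf|].
    apply (@ex_derive_continuous R_AbsRing R_NormedModule).
    exists (/ f (clamp a b t)). now apply Hln.
  - intros t.
    apply (continuous_mult (fun s => f' (clamp a b s)) (fun s => / f (clamp a b s)));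
      [apply Hcf'|].
    now apply continuous_Rinv_comp.
  - intros t Ht.
    apply (is_derive_ext_loc (fun s => ln (f s ^ 2) / 2)).
    { apply filter_imp with (2 := locally_interval a b t Ht).
      intros s Hs. unfold F. now rewrite clamp_id. }
    unfold h. rewrite clamp_id by lra.
    apply (is_derive_comp (fun y => ln (y ^ 2) / 2) f); [|now apply Hd].
    apply Hln, Hnz. lra.
Qed.

Theorem theorem4p27 (L0 : LC2) (gamma : R -> LC2) (t0 t1 : R)
  (ht : t0 < t1)
  (hsmooth : smooth_curve gamma t0 t1)
  (hclosed : gamma t0 = gamma t1)
  (hunit : forall t, t0 <= t <= t1 -> LC2_unit (LC2_sub (gamma t) L0)) :
  line_integral (fun L => LC2_inv (LC2_sub L L0)) gamma t0 t1 = LC2_zero.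
Proof.
  destruct hsmooth as [Hx Hy].
  set (x := fun t => coefI (gamma t)) in *.
  set (y := fun t => coefE (gamma t)) in *.
  set (p := fun t => (x t + y t) + - (coefI L0 + coefE L0)).
  set (q := fun t => (x t + - y t) + - (coefI L0 - coefE L0)).
  assert (Hnorm : forall t,
    (x t - coefI L0) ^ 2 - (y t - coefE L0) ^ 2 = p t * q t).
  { intros t. unfold p, q. ring. }
  assert (Hpq : forall t, t0 <= t <= t1 -> p t <> 0 /\ q t <> 0).
  { intros t Ht.
    assert (Hu : p t * q t <> 0) by (rewrite <- Hnorm; exact (hunit t Ht)).
    split; intros H0; apply Hu; rewrite H0; ring. }
  assert (Ip : is_RInt (fun t => Derive p t / p t) t0 t1 0).
  { apply is_RInt_log_derivative; [exact ht| | |].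
    - apply C1_on_plus; [now apply C1_on_plus | apply C1_on_const].
    - intros t Ht. now apply Hpq.
    - unfold p, x, y. now rewrite hclosed. }
  assert (Iq : is_RInt (fun t => Derive q t / q t) t0 t1 0).
  { apply is_RInt_log_derivative; [exact ht| | |].
    - apply C1_on_plus; [|apply C1_on_const].
      apply C1_on_plus; [exact Hx | now apply C1_on_opp].
    - intros t Ht. now apply Hpq.
    - unfold q, x, y. now rewrite hclosed. }
  assert (Dx : forall t, t0 < t < t1 -> is_derive x t (Derive x t)).
  { intros t Ht. now apply Derive_correct, (C1_on_ex_derive x t0 t1). }
  assert (Dy : forall t, t0 < t < t1 -> is_derive y t (Derive y t)).
  { intros t Ht. now apply Derive_correct, (C1_on_ex_derive y t0 t1). }
  assert (Dp : forall t, t0 < t < t1 -> Derive p t = Derive x t + Derive y t).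
  { intros t Ht. apply is_derive_unique.
    rewrite <- (Rplus_0_r (Derive x t + Derive y t)).
    apply (is_derive_plus (V := R_NormedModule)); [|apply (@is_derive_const R_AbsRing)].
    apply (is_derive_plus (V := R_NormedModule)); auto. }
  assert (Dq : forall t, t0 < t < t1 -> Derive q t = Derive x t - Derive y t).
  { intros t Ht. apply is_derive_unique.
    rewrite <- (Rplus_0_r (Derive x t - Derive y t)).
    apply (is_derive_plus (V := R_NormedModule)); [|apply (@is_derive_const R_AbsRing)].
    apply (is_derive_minus (V := R_NormedModule)); auto. }
  assert (Hcomb : forall (c d : R) (g : R -> R),
    (forall t, t0 < t < t1 -> c * (Derive p t / p t) + d * (Derive q t / q t) = g t) ->
    RInt g t0 t1 = 0).
  { intros c d g Hg. apply is_RInt_unique.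
    apply (is_RInt_ext (fun t => c * (Derive p t / p t) + d * (Derive q t / q t))).
    { rewrite Rmin_left, Rmax_right by lra. exact Hg. }
    replace 0 with (c * 0 + d * 0) by ring.
    apply (@is_RInt_plus R_NormedModule); now apply (@is_RInt_scal R_NormedModule). }
  (* The inverse isomorphism is [(u, v) |-> (u + v)/2 I + (u - v)/2 E]. *)
  unfold line_integral, LC2_zero. f_equal.
  - apply (Hcomb (1 / 2) (1 / 2)). intros t Ht.
    destruct (Hpq t) as [Hp Hq]; [lra|].
    rewrite Dp, Dq by exact Ht.
    cbn [LC2_mul LC2_inv LC2_sub velocity coefI coefE].
    fold x y (x t) (y t). rewrite Hnorm.
    replace (x t - coefI L0) with ((p t + q t) / 2) by (unfold p, q; field).
    replace (y t - coefE L0) with ((p t - q t) / 2) by (unfold p, q; field).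
    field. now split.
  - apply (Hcomb (1 / 2) (- 1 / 2)). intros t Ht.
    destruct (Hpq t) as [Hp Hq]; [lra|].
    rewrite Dp, Dq by exact Ht.
    cbn [LC2_mul LC2_inv LC2_sub velocity coefI coefE].
    fold x y (x t) (y t). rewrite Hnorm.
    replace (x t - coefI L0) with ((p t + q t) / 2) by (unfold p, q; field).
    replace (y t - coefE L0) with ((p t - q t) / 2) by (unfold p, q; field).
    field. now split.
Qed.
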